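(* For each positive integer $d$ and each integer $k\ge 0$, $$|\Lambda_d(k)|=\sum_{i=0}^{\lceil d/2\rceil-1} a_{d,i}(k+1)^{d-2i},$$ where the coefficients satisfy $a_{1,0}=1$ and, for $d\ge 2$, the recursion $$a_{d,i}=2\sum_{\ell=0}^{i}\frac{a_{d-1,\ell}}{d-2\ell}\binom{d-2\ell}{2(i-\ell)}B_{2(i-\ell)},$$ with $B_j$ the $j$-th Bernoulli number. In particular $a_{d,0}=2^{d-1}/d!$ for all $d\ge 1$ and $a_{d,1}=2^{d-3}/(3(d-3)!)$ for all $d\ge 3$.
   Context: For $x\in\mathbb{R}^d$, $\|x\|_1=|x_1|+\cdots+|x_d|$. For integers $d>0$, $k\ge 0$, $\Lambda_d(k)=\{n\in\mathbb{Z}^d:\ \|n\|_1\le k,\ n_1+\cdots+n_d\equiv k \pmod 2\}$. Bernoulli numbers $B_j$ are the standard ones (only even-index ones appear, with $B_0=1$, $B_2=1/6$). *)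

(* Defs.v *)
From HB Require Import structures.
From mathcomp Require Export all_boot all_order all_algebra finmap.
From mathcomp Require Export classical_sets cardinality.

Set Implicit Arguments.
Unset Strict Implicit.
Unset Printing Implicit Defensive.

Import Order.TTheory GRing.Theory Num.Theory.

Local Open Scope classical_set_scope.
Local Open Scope ring_scope.

Definition l1norm (R : numDomainType) (d : nat) (x : 'rV[R]_d) : R :=
  \sum_(i < d) `|x 0 i|.

Definition Lambda (d k : nat) : set 'rV[int]_d :=
  [set n : 'rV[int]_d |
    l1norm n <= k%:Z /\ (\sum_(i < d) n 0 i = k%:Z %[mod 2])%Z].

Arguments Lambda : clear implicits.

(* [:: B_0; ...; B_(n-1)], each term being computed from the previous ones by
   the defining recurrence proved below as [bernoulliE]. *)
Fixpoint bernoulli_seq (n : nat) : seq rat :=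
  if n is m.+1 then
    let s := bernoulli_seq m in
    rcons s (((m == 0)%:R - \sum_(j < m) 'C(m.+1, j)%:R * s`_j) / m.+1%:R)
  else [::].

Definition bernoulli (n : nat) : rat := (bernoulli_seq n.+1)`_n.

Lemma size_bernoulli_seq n : size (bernoulli_seq n) = n.
Proof. by elim: n => //= n IHn; rewrite size_rcons IHn. Qed.

Lemma nth_bernoulli_seq n j : (j < n)%N -> (bernoulli_seq n)`_j = bernoulli j.
Proof.
elim: n => // n IHn; rewrite ltnS leq_eqVlt => /predU1P[-> //|lt_jn].
by rewrite /= nth_rcons size_bernoulli_seq lt_jn IHn.
Qed.

Lemma bernoulliE n :
  \sum_(j < n.+1) 'C(n.+1, j)%:R * bernoulli j = (n == 0)%:R.
Proof.
rewrite big_ord_recr /= {2}/bernoulli /= nth_rcons size_bernoulli_seq ltnn eqxx.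
rewrite binSn mulrC divfK ?pnatr_eq0 //.
under [X in _ - X]eq_bigr => j _ do rewrite nth_bernoulli_seq //.
by rewrite addrC subrK.
Qed.

(* The coefficients a_{d,i} exist only for 0 <= i <= ceil(d/2) - 1.  For odd
   d >= 3 and i = (d-1)/2, the recursion formally involves the index pair
   (d-1, i), which is out of this range: as usual, missing coefficients are
   read as 0. *)
Fixpoint acoef (d i : nat) : rat :=
  match d with
  | 0 => 0
  | d'.+1 =>
    match d' with
    | 0 => (i == 0)%:R
    | _ =>
      if (i < uphalf d)%N then
        2 * \sum_(l < i.+1) acoef d' l / (d - 2 * l)%:R
              * 'C(d - 2 * l, 2 * (i - l))%:R * bernoulli (2 * (i - l))
      else 0
    end
  end.

(* Main.v *)
(* Slicing Lambda_(d+1)(k) by its first coordinate z leaves Lambda_d(k - |z|),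
   so f_(d+1)(k) = f_d(k) + 2 (f_d(0) + ... + f_d(k-1)) for f_d = |Lambda_d|.
   In the variable K = k+1 this sends K^p to K^p + 2 (0^p + ... + (K-1)^p),
   which by Faulhaber's formula is a combination of the K^(p+1-2t): the extra
   K^p cancels the B_1 term and the other odd Bernoulli numbers vanish.
   Collecting powers of K gives exactly the recursion for the coefficients. *)

Require Import Defs.
From mathcomp Require Import zify ring lra.

Set Implicit Arguments.
Unset Strict Implicit.
Unset Printing Implicit Defensive.

Import Order.TTheory GRing.Theory Num.Theory.
Local Open Scope classical_set_scope.
Local Open Scope ring_scope.

(** * Faulhaber's formula and Bernoulli numbers of odd index *)

Lemma bernoulli0 : bernoulli 0 = 1.
Proof. by have := bernoulliE 0; rewrite big_ord1 bin0 mul1r. Qed.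

(** This is the Bernoulli polynomial of degree [p.+1] without its constant term. *)
Definition faulhaber (p : nat) : {poly rat} :=
  \sum_(j < p.+1) ('C(p.+1, j)%:R * bernoulli j) *: 'X^(p.+1 - j).

Lemma horner_faulhaber (p : nat) (x : rat) :
  (faulhaber p).[x]
    = \sum_(j < p.+1) 'C(p.+1, j)%:R * bernoulli j * x ^+ (p.+1 - j).
Proof. by rewrite horner_sum; apply: eq_bigr => j _; rewrite !hornerE. Qed.

Lemma mul_bin_trinomial (n i j : nat) : (i + j <= n)%N ->
  ('C(n, j) * 'C(n - j, i) = 'C(n, i) * 'C(n - i, j))%N.
Proof.
move=> le_ijn.
have f_gt0 : (0 < i`! * j`! * (n - i - j)`!)%N by rewrite !muln_gt0 !fact_gt0.
have Hj : ('C(n, j) * (j`! * (n - j)`!) = n`!)%N by apply: bin_fact; lia.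
have Hi : ('C(n, i) * (i`! * (n - i)`!) = n`!)%N by apply: bin_fact; lia.
have Hji : ('C(n - j, i) * (i`! * (n - j - i)`!) = (n - j)`!)%N.
  by apply: bin_fact; lia.
have Hij : ('C(n - i, j) * (j`! * (n - i - j)`!) = (n - i)`!)%N.
  by apply: bin_fact; lia.
apply/eqP; rewrite -(eqn_pmul2r f_gt0); apply/eqP.
transitivity n`!; [rewrite -Hj -Hji subnAC | rewrite -Hi -Hij]; ring.
Qed.

(** After binomial expansion and exchange of sums, the coefficient of [x ^+ i] is a multiple of the
    sum in [bernoulliE] at [p - i], which vanishes unless [i = p]. *)
Lemma faulhaber_diff (p : nat) (x : rat) :
  (faulhaber p).[x + 1] - (faulhaber p).[x] = p.+1%:R * x ^+ p.
Proof.
rewrite !horner_faulhaber -sumrB.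
transitivity (\sum_(j < p.+1) \sum_(i < p.+1 | (i + j < p.+1)%N)
    'C(p.+1, i)%:R * x ^+ i * ('C(p.+1 - i, j)%:R * bernoulli j)).
  apply: eq_bigr => j _; rewrite -mulrBr [x + 1]addrC exprDn big_ord_recr /=.
  rewrite subnn expr0 mul1r binn mulr1n addrK mulr_sumr.
  rewrite (big_ord_widen_cond p.+1 predT
    (fun i => 'C(p.+1, j)%:R * bernoulli j *
       (1 ^+ (p.+1 - j - i) * x ^+ i *+ 'C(p.+1 - j, i)))) ?leq_subr //=.
  apply: eq_big => [i|i lt_i]; first by rewrite ltn_subRL addnC.
  rewrite expr1n mul1r -mulr_natl.
  have := @mul_bin_trinomial p.+1 i j; rewrite addnC.
  move=> /(_ ltac:(lia)) /(congr1 (fun n => n%:R : rat)); rewrite !natrM => E.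
  by ring: E.
rewrite (exchange_big_dep predT) //=.
(* For [i = p] the condition [i + j < p.+1] leaves only [j = 0]. *)
rewrite (bigD1 ord_max) //= [X in _ + X]big1 ?addr0.
  rewrite -mulr_sumr (bigD1 ord0) ?addn0 //= big1 => [|j /andP[]]; last first.
    by rewrite -val_eqE /=; lia.
  by rewrite /= bin0 bernoulli0 !mulr1 binSn.
move=> i ne_i; have lt_ip : (i < p)%N.
  by move: ne_i (ltn_ord i); rewrite -val_eqE /=; lia.
rewrite -mulr_sumr.
have -> : \sum_(j < p.+1 | (i + j < p.+1)%N) 'C(p.+1 - i, j)%:R * bernoulli j
        = \sum_(j < (p - i).+1) 'C((p - i).+1, j)%:R * bernoulli j.
  rewrite (big_ord_widen_cond p.+1 predT
    (fun j => 'C((p - i).+1, j)%:R * bernoulli j)) ?ltnS ?leq_subr //=.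
  by apply: eq_big => [j|j _]; [lia | rewrite subSn // ltnW].
by rewrite bernoulliE subn_eq0 leqNgt lt_ip mulr0.
Qed.

Lemma faulhaber0 (p : nat) : (faulhaber p).[0] = 0.
Proof.
rewrite horner_faulhaber big1 // => j _.
by rewrite expr0n subn_eq0 leqNgt ltn_ord mulr0.
Qed.

Lemma sum_expr_faulhaber (p K : nat) :
  p.+1%:R * \sum_(m < K) m%:R ^+ p = (faulhaber p).[K%:R].
Proof.
elim: K => [|K IHK]; first by rewrite big_ord0 mulr0 faulhaber0.
by rewrite big_ord_recr /= mulrDr IHK -faulhaber_diff -natr1 addrC subrK.
Qed.

(** Otherwise the nonzero [p - q] would have as many distinct roots 0, 1, ... as its size, one more
    than its degree. *)
Lemma poly_eq_on_nat (p q : {poly rat}) :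
  (forall n : nat, p.[n%:R] = q.[n%:R]) -> p = q.
Proof.
move=> eq_pq; apply/eqP; rewrite -subr_eq0; apply/negPn/negP => nz.
have /= := @max_poly_roots _ (p - q) [seq n%:R | n <- iota 0 (size (p - q))] nz.
rewrite size_map size_iota ltnn => H; suff: false by []; apply: H.
  by apply/allP => _ /mapP[n _ ->]; rewrite /root !hornerE eq_pq subrr.
rewrite map_inj_uniq ?iota_uniq // => m n /eqP.
by rewrite eqr_nat => /eqP.
Qed.

(* Both sides vanish at 0 and have forward difference (p+1)(x+1)^p. *)
Lemma faulhaber_reflection (p : nat) : (0 < p)%N ->
  (-1) ^+ p.+1 *: (faulhaber p \Po (- 'X)) = faulhaber p + p.+1%:R *: 'X^p.
Proof.
move=> p_gt0; apply: poly_eq_on_nat; elim=> [|n IHn].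
  rewrite !hornerE horner_comp !hornerE oppr0 faulhaber0 expr0n.
  by rewrite gtn_eqF ?mulr0 ?addr0.
move: IHn; rewrite !hornerE !horner_comp !hornerE => IHn.
have E1 := faulhaber_diff p (- n.+1%:R).
have E2 := faulhaber_diff p n%:R.
have e1 : - n.+1%:R + 1 = - n%:R :> rat by rewrite -natr1; ring.
have e2 : n%:R + 1 = n.+1%:R :> rat by rewrite natr1.
rewrite e1 exprNn in E1; rewrite e2 in E2.
have sg : (-1) ^+ p.+1 * (-1) ^+ p = -1 :> rat.
  by rewrite exprS -mulrA -exprD addnn -signr_odd odd_double mulr1.
have -> : (faulhaber p).[- n.+1%:R]
   = (faulhaber p).[- n%:R] - p.+1%:R * ((-1) ^+ p * n.+1%:R ^+ p).
  by rewrite -E1; ring.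
rewrite mulrBr IHn.
have -> : (-1) ^+ p.+1 * (p.+1%:R * ((-1) ^+ p * n.+1%:R ^+ p))
  = ((-1) ^+ p.+1 * (-1) ^+ p) * (p.+1%:R * n.+1%:R ^+ p) :> rat by ring.
by rewrite sg -E2; ring.
Qed.

Lemma coef_faulhaber1 (p : nat) : (faulhaber p)`_1 = p.+1%:R * bernoulli p.
Proof.
rewrite coef_sum (bigD1 ord_max) //= big1 ?addr0 => [|j].
  by rewrite coefZ coefXn subSnn eqxx mulr1 binSn.
rewrite -val_eqE coefZ coefXn /= => ne_jp.
have -> : (1 == p.+1 - j)%N = false by have := ltn_ord j; lia.
by rewrite mulr0.
Qed.

(** Linear coefficients are compared in [faulhaber_reflection]: for odd [p] the left side negates
    that of [faulhaber p], and ['X^p] contributes nothing since [p > 1]. *)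
Lemma bernoulli_odd (p : nat) : odd p -> (1 < p)%N -> bernoulli p = 0.
Proof.
move=> odd_p p_gt1.
have := faulhaber_reflection (ltnW p_gt1).
move/(congr1 (fun q : {poly rat} => q`_1)).
have -> : faulhaber p \Po (- 'X) =
  \poly_(i < size (faulhaber p)) ((-1) ^+ i * (faulhaber p)`_i).
  rewrite comp_polyE poly_def; apply: eq_bigr => i _.
  rewrite (exprNn 'X) -signr_odd mulr_sign -scaler_sign.
  by rewrite scalerA mulrC signr_odd.
rewrite coefZ coef_poly coefD coefZ coefXn ltn_eqF // mulr0 addr0.
rewrite -[(-1) ^+ p.+1]signr_odd /= odd_p expr0 expr1 mul1r mulN1r.
(* If the size is at most 1, the truncated polynomial has linear coefficient 0, and [E] gives the
   vanishing at once. *)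
case: ltnP => [_|le_sz] E.
  have : p.+1%:R * bernoulli p = 0 by move: E; rewrite coef_faulhaber1; lra.
  by move/eqP; rewrite mulf_eq0 pnatr_eq0 => /eqP.
by move/eqP: (esym E); rewrite coef_faulhaber1 mulf_eq0 pnatr_eq0 => /eqP.
Qed.

Lemma sum_even_terms (V : zmodType) (g : nat -> V) (n : nat) :
  (forall j, odd j -> g j = 0) ->
  \sum_(j < n) g j = \sum_(t < uphalf n) g (2 * t)%N.
Proof.
move=> g_odd; elim: n => [|n IHn]; first by rewrite !big_ord0.
rewrite big_ord_recr IHn /=; have [odd_n|even_n] := boolP (odd n).
  by rewrite g_odd // addr0 uphalf_half odd_n.
rewrite uphalf_half (negbTE even_n) add0n big_ord_recr /=.
by rewrite mul2n halfK (negbTE even_n) subn0.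
Qed.

Lemma bernoulli1 : bernoulli 1 = - 2^-1.
Proof.
have := bernoulliE 1.
by rewrite !big_ord_recr big_ord0 /= bernoulli0 bin0 binSn; lra.
Qed.

Lemma bernoulli2 : bernoulli 2 = 6^-1.
Proof.
have := bernoulliE 2; rewrite !big_ord_recr big_ord0 /= bernoulli0 bernoulli1.
rewrite bin0 binSn bin1; lra.
Qed.

(* The term K^p cancels the contribution of B_1, the only nonzero Bernoulli
   number of odd index. *)
Lemma trapezoid_faulhaber (p K : nat) : (0 < p)%N ->
  K%:R ^+ p + 2 * \sum_(m < K) m%:R ^+ p
  = 2 / p.+1%:R * \sum_(t < uphalf p.+1)
      'C(p.+1, 2 * t)%:R * bernoulli (2 * t) * K%:R ^+ (p.+1 - 2 * t) :> rat.
Proof.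
move=> p_gt0; have nz : p.+1%:R != 0 :> rat by rewrite pnatr_eq0.
pose g j := 'C(p.+1, j)%:R * bernoulli j * K%:R ^+ (p.+1 - j) : rat.
(* [h] erases every odd term, including the nonzero [g 1], so that [sum_even_terms] applies. *)
pose h j := if odd j then 0 else g j.
have -> : \sum_(t < uphalf p.+1) 'C(p.+1, 2 * t)%:R * bernoulli (2 * t)
             * K%:R ^+ (p.+1 - 2 * t) = \sum_(j < p.+1) h j.
  rewrite (@sum_even_terms _ h) => [|j]; last by rewrite /h => ->.
  by apply: eq_bigr => t _; rewrite /h mul2n odd_double.
have -> : \sum_(j < p.+1) h j = \sum_(j < p.+1) g j - g 1%N.
  have lt1p : (1 < p.+1)%N by [].
  rewrite (bigD1 (Ordinal lt1p) (F := fun j : 'I__ => h j)) //=.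
  rewrite (bigD1 (Ordinal lt1p) (F := fun j : 'I__ => g j)) //=.
  rewrite {1}/h /= add0r [g 1%N + _]addrC addrK; apply: eq_bigr => j ne_j1.
  rewrite /h; case: ifP => // odd_j; rewrite /g bernoulli_odd ?mulr0 ?mul0r //.
  by move: ne_j1 odd_j; rewrite -val_eqE /=; case: (j : nat) => [|[]].
rewrite -horner_faulhaber -sum_expr_faulhaber /g bin1 bernoulli1 subSS subn0.
by move: (p.+1%:R : rat) nz => P nz; field.
Qed.

(** * The recursion for the coefficients as a summation identity *)

Lemma acoefS (d i : nat) : (0 < d)%N -> (i < uphalf d.+1)%N ->
  acoef d.+1 i = 2 * \sum_(l < i.+1) acoef d l / (d.+1 - 2 * l)%:R
                  * 'C(d.+1 - 2 * l, 2 * (i - l))%:R * bernoulli (2 * (i - l)).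
Proof. by case: d => // d _ lt_i; rewrite [LHS]/= -/(uphalf d.+2) lt_i. Qed.

Lemma acoef_out (d i : nat) : (uphalf d <= i)%N -> acoef d i = 0.
Proof.
case: d => [//|[|d]] le_i; first by case: i le_i.
by rewrite [LHS]/= ltnNge le_i.
Qed.

(** The claimed count, with [x] standing for [k + 1]. *)
Definition apoly (d : nat) (x : rat) : rat :=
  \sum_(i < uphalf d) acoef d i * x ^+ (d - 2 * i).

Lemma apolyS (d K : nat) : (0 < d)%N ->
  apoly d.+1 K%:R = apoly d K%:R + 2 * \sum_(m < K) apoly d m%:R.
Proof.
move=> d_gt0; set N := uphalf d.+1.
(* [G l i] is the contribution of [acoef d l] to the term of degree [d.+1 - 2 * i]. Summing over [l]
   gives the recursion; summing over [i] gives the image of one monomial. *)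
pose G l i : rat := 2 * (acoef d l / (d.+1 - 2 * l)%:R
      * 'C(d.+1 - 2 * l, 2 * (i - l))%:R * bernoulli (2 * (i - l)))
      * K%:R ^+ (d.+1 - 2 * i).
transitivity (\sum_(l < uphalf d) \sum_(i < N | (l <= i)%N) G l i).
  (* For even [d], [N] exceeds [uphalf d] by one; the extra row is zero by [acoef_out]. *)
  have -> : \sum_(l < uphalf d) \sum_(i < N | (l <= i)%N) G l i
          = \sum_(l < N) \sum_(i < N | (l <= i)%N) G l i.
    have le_dN : (uphalf d <= N)%N by rewrite /N; lia.
    rewrite (big_ord_widen_cond N predT
      (fun l => \sum_(i < N | (l <= i)%N) G l i)) //=.
    rewrite big_mkcond; apply: eq_bigr => l _; case: ltnP => // le_l.
    by rewrite big1 // => i _; rewrite /G acoef_out // !mul0r.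
  rewrite (exchange_big_dep predT) //=; apply: eq_bigr => i _.
  rewrite acoefS // mulr_sumr mulr_suml.
  by rewrite (big_ord_widen_cond N predT (fun l => G l i)) ?ltn_ord //.
rewrite /apoly exchange_big /= mulr_sumr -big_split /=.
apply: eq_bigr => l _; rewrite -mulr_sumr.
have lt_l : (2 * l < d)%N by have := ltn_ord l; lia.
set p := (d - 2 * l)%N.
have defp : (d.+1 - 2 * l = p.+1)%N by rewrite /p; lia.
rewrite mulrCA -mulrDr trapezoid_faulhaber /p ?subn_gt0 // -/p.
have -> : uphalf p.+1 = (N - l)%N by rewrite /N /p; lia.
rewrite mulrA mulr_sumr.
(* The Faulhaber index is [t = i - l]. *)
transitivity (\sum_(l <= i < N) G l i); first by rewrite big_geq_mkord.
rewrite -{1}[l : nat]add0n big_addn big_mkord; apply: eq_bigr => t _.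
rewrite /G addnK defp.
have -> : (d.+1 - 2 * (t + l) = p.+1 - 2 * t)%N by rewrite /p; lia.
by rewrite !mulrA; ring.
Qed.

Lemma apoly1 (x : rat) : apoly 1 x = x.
Proof. by rewrite /apoly big_ord1 /= mul1r expr1. Qed.

(** All exponents are positive. This removes the term [m = 0] of [apolyS], which matches no count
    since counts sit at arguments [k + 1]. *)
Lemma apoly_at0 (d : nat) : apoly d 0 = 0.
Proof.
rewrite /apoly big1 // => i _; rewrite expr0n.
by rewrite (_ : (_ == 0)%N = false) ?mulr0 //; have := ltn_ord i; lia.
Qed.

(** * Closed forms of the first two coefficients *)

Lemma acoef_lead (d : nat) : acoef d.+1 0 = 2 ^+ d / d.+1`!%:R.
Proof.
elim: d => [|d IHd]; first by rewrite /= divr1.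
rewrite acoefS // big_ord1 IHd bin0 bernoulli0 !mulr1 subn0.
rewrite [in RHS]factS natrM exprS.
have : d.+1`!%:R != 0 :> rat by rewrite pnatr_eq0 -lt0n fact_gt0.
have : d.+2%:R != 0 :> rat by rewrite pnatr_eq0.
by move: (_%:R) (_%:R) => a b ha hb; field; rewrite ha hb.
Qed.

Lemma acoef_second (d : nat) : acoef d.+3 1 = 2 ^+ d / (3 * d`!%:R).
Proof.
(* The first summand is the term [l = 0], with the leading coefficient and [B_2 = 1/6]; the second
   is [l = 1], with [B_0]. *)
have step n : acoef n.+3 1
    = 2 ^+ n / (3 * n.+1`!%:R) + 2 * (acoef n.+2 1 / n.+1%:R).
  rewrite acoefS //; move: (acoef n.+2) (acoef_lead n.+1) => a a0E.
  rewrite !big_ord_recr big_ord0 /= a0E bernoulli0 bernoulli2 bin0.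
  rewrite add0r !mulr1 subn0.
  have -> : (n.+3 - 2 = n.+1)%N by lia.
  rewrite mulrDr; congr (_ + _).
  have -> : 'C(n.+3, 2)%:R = n.+3%:R * n.+2%:R / 2 :> rat.
    have := mul_bin_diag n.+3 1; rewrite bin1.
    move/(congr1 (fun m => m%:R : rat)).
    by rewrite !natrM => ->; field.
  rewrite [n.+2`!]factS natrM exprS.
  have h1 : n.+1`!%:R != 0 :> rat by rewrite pnatr_eq0 -lt0n fact_gt0.
  have h2 : n.+2%:R != 0 :> rat by rewrite pnatr_eq0.
  have h3 : n.+3%:R != 0 :> rat by rewrite pnatr_eq0.
  move: (n.+1`!%:R : rat) (n.+2%:R : rat) (n.+3%:R : rat) h1 h2 h3.
  by move=> x y z hx hy hz; field; rewrite hx hy hz.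
elim: d => [|d IHd].
  (* [acoef 2 1] is out of range, hence 0. *)
  by rewrite step acoef_out // mul0r mulr0 addr0.
rewrite step IHd !factS !natrM exprS.
have h1 : d`!%:R != 0 :> rat by rewrite pnatr_eq0 -lt0n fact_gt0.
have h2 : d.+1%:R != 0 :> rat by rewrite pnatr_eq0.
have h3 : d.+2%:R != 0 :> rat by rewrite pnatr_eq0.
have e : d.+2%:R = d.+1%:R + 1 :> rat by rewrite natr1.
rewrite e in h3 *; move: (d`!%:R : rat) (d.+1%:R : rat) h1 h2 h3.
by move=> a b ha hb hc; field; rewrite ha hb hc.
Qed.

(** * Enumeration and count of the lattice points *)

Definition int_range (k : nat) : seq int :=
  [seq Posz j | j <- iota 0 k.+1] ++ [seq Negz j | j <- iota 0 k].

Lemma mem_int_range (k : nat) (z : int) : (z \in int_range k) = (`|z| <= k)%N.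
Proof.
rewrite mem_cat; case: z => n.
  rewrite mem_map => [|? ? []] //; rewrite mem_iota add0n ltnS.
  rewrite leq0n andTb absz_nat; case: leqP => // _; rewrite orFb.
  by apply/negbTE/mapP => -[].
rewrite orbC mem_map => [|? ? []] //; rewrite mem_iota add0n.
rewrite leq0n andTb [absz _]/=; case: ltnP => // _; rewrite orFb.
by apply/negbTE/mapP => -[].
Qed.

Lemma int_range_uniq (k : nat) : uniq (int_range k).
Proof.
rewrite cat_uniq !map_inj_uniq ?iota_uniq ?andbT => [|? ? []|? ? []] //.
by apply/hasPn => _ /mapP[n _ ->]; apply/mapP => -[].
Qed.

Fixpoint Lambda_seq (d k : nat) : seq 'rV[int]_d :=
  match d with
  | 0 => if odd k then [::] else [:: 0]
  | d'.+1 => [seq (row_mx (z%:M : 'M_1) v : 'rV[int]_(1 + d'))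
                | z <- int_range k, v <- Lambda_seq d' (k - `|z|)]
  end.

Lemma Lambda_seqS (d k : nat) :
  Lambda_seq d.+1 k = [seq (row_mx (z%:M : 'M_1) v : 'rV[int]_(1 + d))
                         | z <- int_range k, v <- Lambda_seq d (k - `|z|)].
Proof. by []. Qed.

Lemma Lambda_seq_uniq (d k : nat) : uniq (Lambda_seq d k).
Proof.
elim: d k => [|d IHd] k; first by rewrite /=; case: ifP.
rewrite Lambda_seqS; apply: allpairs_uniq_dep => [|z _|].
- exact: int_range_uniq.
- exact: IHd.
move=> [z v] [z' v'] _ _ /= /(@eq_row_mx int 1 1 d)[/matrixP/(_ 0 0)].
by rewrite !mxE eqxx !mulr1n => -> ->.
Qed.

(** Since [z] and its absolute value have the same parity, the congruence passes to [v]; the bound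
    on [z] keeps the natural subtraction from truncating. *)
Lemma Lambda_row_mx (d k : nat) (z : int) (v : 'rV[int]_d) :
  Lambda (1 + d) k (row_mx (z%:M : 'M_1) v)
  <-> (`|z| <= k)%N /\ Lambda d (k - `|z|) v.
Proof.
rewrite /Lambda /l1norm /= !big_split_ord /= !big_ord1 !row_mxEl.
rewrite !mxE eqxx mulr1n.
under eq_bigr do rewrite row_mxEr.
under [X in (_ + X = _ %[mod _])%Z]eq_bigr do rewrite row_mxEr.
set S := \sum_(i < d) `|v 0 i|; set T := \sum_(i < d) v 0 i.
have S_ge0 : 0 <= S by apply: sumr_ge0.
by move: S T S_ge0 => S T S_ge0; lia.
Qed.

Lemma Lambda_seqP (d k : nat) (v : 'rV[int]_d) :
  v \in Lambda_seq d k <-> Lambda d k v.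
Proof.
elim: d k v => [|d IHd] k v.
  rewrite /Lambda /l1norm /= !big_ord0 (thinmx0 v).
  case: ifP => odd_k; rewrite ?inE ?eqxx; split => //; lia.
rewrite -[v](@hsubmxK _ 1 1 d) (mx11_scalar (lsubmx _)).
move: (lsubmx _ 0 0) (rsubmx _) => z {}v.
rewrite (Lambda_row_mx k z v) -mem_int_range -IHd.
split=> [/allpairsPdep[z' [v' [z'_in v'_in]]]|[z_in v_in]].
  move=> /(@eq_row_mx int 1 1 d)[/matrixP/(_ 0 0)].
  by rewrite !mxE eqxx !mulr1n => -> ->.
by apply/allpairsPdep; exists z, v.
Qed.

Lemma size_Lambda_seqS (d k : nat) :
  size (Lambda_seq d.+1 k)
  = (size (Lambda_seq d k) + 2 * \sum_(m < k) size (Lambda_seq d m))%N.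
Proof.
have iotaE n : iota 0 n = index_iota 0 n by rewrite /index_iota subn0.
rewrite Lambda_seqS size_allpairs_dep sumnE big_map big_cat !big_map !iotaE.
(* [big_ord_recl] isolates [z = 0]. The positive and the negative [z] each give one copy of the sum,
   listed in reverse order. *)
rewrite !big_mkord /= big_ord_recl subn0 -addnA mul2n -addnn.
congr (_ + (_ + _))%N.
  rewrite [RHS](reindex_inj rev_ord_inj); apply: eq_bigr => i _.
  by rewrite /= /bump.
by rewrite [RHS](reindex_inj rev_ord_inj); apply: eq_bigr.
Qed.

(** The induction starts in dimension 1, because the count in dimension 0 depends on the parity of
    [k] and is not polynomial. *)
Lemma size_Lambda_seq (d k : nat) :
  (size (Lambda_seq d.+1 k))%:R = apoly d.+1 k.+1%:R.
Proof.
elim: d k => [|d IHd] k.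
  rewrite apoly1; congr _%:R; rewrite size_Lambda_seqS.
  (* This counts the even [m < k]; either parity of [k] then yields the total [k + 1]. *)
  have -> : (\sum_(m < k) size (Lambda_seq 0 m) = uphalf k)%N.
    elim: k => [|k IHk]; first by rewrite big_ord0.
    by rewrite big_ord_recr IHk /=; case: ifP => /= odd_k; lia.
  by rewrite /=; case: ifP => /= odd_k; lia.
rewrite size_Lambda_seqS natrD natrM natr_sum apolyS // IHd; congr (_ + _ * _).
rewrite big_ord_recl apoly_at0 add0r.
by apply: eq_bigr => m _; rewrite IHd.
Qed.

Theorem theorem2p3 :
  [/\ forall d k : nat, (0 < d)%N ->
        finite_set (Lambda d k) /\
        (#|` fset_set (Lambda d k)|%fset)%:R
          = \sum_(i < uphalf d) acoef d i * (k.+1)%:R ^+ (d - 2 * i) :> rat,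
      acoef 1 0 = 1,
      forall d i : nat, (2 <= d)%N -> (i < uphalf d)%N ->
        acoef d i
          = 2 * \sum_(l < i.+1) acoef d.-1 l / (d - 2 * l)%:R
                  * 'C(d - 2 * l, 2 * (i - l))%:R * bernoulli (2 * (i - l)),
      forall d : nat, (1 <= d)%N -> acoef d 0 = 2 ^+ (d - 1) / (d`!)%:R
    & forall d : nat, (3 <= d)%N ->
        acoef d 1 = 2 ^+ (d - 3) / (3 * ((d - 3)`!)%:R)].
Proof.
split.
- case=> // d k _; rewrite -/(apoly d.+1 k.+1%:R) -size_Lambda_seq.
  have -> : Lambda d.+1 k = [set` Lambda_seq d.+1 k].
    by apply/seteqP; split=> v; rewrite /= Lambda_seqP.
  move: (Lambda_seq d.+1 k) (Lambda_seq_uniq d.+1 k) => s s_uniq.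
  split; first exact: finite_seq.
  have -> : fset_set [set` s] = [fset v in s]%fset.
    apply/fsetP => v; rewrite in_fset_set; last exact: finite_seq.
    by rewrite mem_setE !inE.
  by rewrite card_fseq undup_id.
- by [].
- by case=> [|[|d]] // i _; exact: acoefS.
- by case=> // d _; rewrite subn1 acoef_lead.
- by case=> [|[|[|d]]] // _; rewrite !subSS subn0 acoef_second.
Qed.
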